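(* Let $k,N\ge 1$ be integers and let $m$ be an integer with $(k-1)N<m<kN$. Then $$I_k(m;N)=\binom{kN-m+k^2-1}{k^2-1}.$$
   Context: For an $N\times N$ matrix $U$, the secular coefficients $\operatorname{Sc}_j(U)$ are defined by $\det(I+xU)=\sum_{j=0}^N \operatorname{Sc}_j(U)x^j$. With $U(N)$ the group of $N\times N$ unitary matrices and $dU$ its Haar probability measure, define $$I_k(m;N)=\int_{U(N)}\Big|\sum_{\substack{j_1+\cdots+j_k=m\\ 0\le j_1,\dots,j_k\le N}}\operatorname{Sc}_{j_1}(U)\cdots\operatorname{Sc}_{j_k}(U)\Big|^2\,dU .$$ *)

(* Defs.v *)
From HB Require Import structures.
From mathcomp Require Import all_boot all_order all_algebra.
From mathcomp Require Import complex.
From mathcomp Require Import all_classical all_reals all_analysis.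

Set Implicit Arguments.
Unset Strict Implicit.
Unset Printing Implicit Defensive.

Import Order.TTheory GRing.Theory Num.Theory.
Import numFieldNormedType.Exports.

Local Open Scope classical_set_scope.
Local Open Scope ring_scope.
Local Open Scope complex_scope.

Record unitary_group (R : realType) (N : nat) := UnitaryGroup {
  umx :> 'M[R[i]]_N;
  umxP : umx \is unitarymx
}.

HB.instance Definition _ R N := [isSub for @umx R N].
HB.instance Definition _ R N := [Choice of unitary_group R N by <:].

Section unitary_group_structure.
Variables (R : realType) (N : nat).
Implicit Types U V W : unitary_group R N.

Fact unitary1_subproof : (1%:M : 'M[R[i]]_N) \is unitarymx.
Proof. by apply/unitarymxP; rewrite trmx1 map_mx1 mulmx1. Qed.

Definition unitary1 := UnitaryGroup unitary1_subproof.

Definition unitary_mul U V := UnitaryGroup (mul_unitarymx (umxP U) (umxP V)).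

Fact unitary_inv_subproof U : invmx U \is unitarymx.
Proof. by rewrite (invmx_unitary (umxP U)) trmxC_unitary umxP. Qed.

Definition unitary_inv U := UnitaryGroup (unitary_inv_subproof U).

Fact unitary_mulA : associative unitary_mul.
Proof. by move=> U V W; apply: val_inj; rewrite /= mulmxA. Qed.

Fact unitary_mul1 : left_id unitary1 unitary_mul.
Proof. by move=> U; apply: val_inj; rewrite /= mul1mx. Qed.

Fact unitary_mulr1 : right_id unitary1 unitary_mul.
Proof. by move=> U; apply: val_inj; rewrite /= mulmx1. Qed.

Fact unitary_mulV : left_inverse unitary1 unitary_inv unitary_mul.
Proof.
by move=> U; apply: val_inj; rewrite /= mulVmx // (unitarymx_unit (umxP U)).
Qed.

Fact unitary_mulrV : right_inverse unitary1 unitary_inv unitary_mul.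
Proof.
by move=> U; apply: val_inj; rewrite /= mulmxV // (unitarymx_unit (umxP U)).
Qed.

HB.instance Definition _ := isGroup.Build (unitary_group R N)
  unitary_mulA unitary_mul1 unitary_mulr1 unitary_mulV unitary_mulrV.

HB.instance Definition _ := isPointed.Build (unitary_group R N) unitary1.

(* R[i] itself carries no topology in the library, but its alias R[i]^o does,
   namely the one given by the modulus; U(N) gets the subspace topology and
   its Borel sigma-algebra. *)
Definition unitary_incl (U : unitary_group R N) : 'M[R[i]^o]_N := umx U.

HB.instance Definition _ :=
  Topological.copy (unitary_group R N) (initial_topology unitary_incl).

HB.instance Definition _ := Measurable.copy (unitary_group R N)
  (g_sigma_algebraType (@open (unitary_group R N))).

End unitary_group_structure.

(* Haar probability measure: U(N) being compact, left invariance characterizes it. *)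
Definition haar (R : realType) (N : nat)
    (mu : probability (unitary_group R N) R) : Prop :=
  forall (V : unitary_group R N) (A : set (unitary_group R N)),
    measurable A -> mu [set (V * W)%g | W in A] = mu A.

Definition secular_coef (C : comNzRingType) (N : nat) (U : 'M[C]_N) (j : nat) : C :=
  (\det (1%:M + 'X *: map_mx polyC U))`_j.

Definition secular_moment (R : realType) (N : nat)
    (mu : probability (unitary_group R N) R) (k m : nat) : \bar R :=
  (\int[mu]_U ((Normc.normc
     (\sum_(j : {ffun 'I_k -> 'I_N.+1} | (\sum_(i < k) j i)%N == m)
        \prod_(i < k) secular_coef U (j i))) ^+ 2)%:E)%E.

(* Main.v *)
Require Import Defs.
From HB Require Import structures.
From mathcomp Require Import all_boot all_order all_algebra all_fingroup.
From mathcomp Require Import complex mxtens.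
From mathcomp Require Import all_classical all_reals all_analysis.
From mathcomp Require Import measurable_realfun.

Set Implicit Arguments.
Unset Strict Implicit.
Unset Printing Implicit Defensive.

Import Order.TTheory GRing.Theory Num.Theory.
Import numFieldNormedType.Exports.

Local Open Scope ring_scope.

(** The products of secular coefficients in the integrand add up to the
coefficient of [X ^ m] in [det (1 + X U) ^ k]. For unitary [U] this polynomial
has a functional equation ([det_power_coef_rev]), so up to a factor of modulus
one the coefficient may be replaced by the conjugate of the coefficient [c_n] of
[X ^ n], where [n = k N - m]. The hypothesis on [m] makes [n] at most [N], and
this is the range in which the statistics of [U] are those of permutations.

Expanding [det (1 + X U) ^ k], which is the determinant of [1 + X M] for [M] the
Kronecker product of the identity with [U], into principal minors gives
([coef_det_exp]) [n! c_n] as the sum over permutations [s] of [n] letters of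
[sgn s * fix_k s * T_s U]. Here [fix_k s] counts the colourings of the [n]
letters with [k] colours that are invariant under [s], and [T_s U] is the trace
of [s] composed with the [n]-th tensor power of [U].

The analytic input is [expectC_perm_trace]: the expectation of [T_s] times the
conjugate of [T_t] is the number of [r] with [t = s ^ r]. Averaging the
conjugates of an operator on the tensor power over the group yields an operator
commuting with the tensor powers of all unitary matrices. Such an operator
commutes with the tensor powers of diagonal matrices (by weights), hence of
normal matrices (by the spectral theorem), hence of matrices of arbitrary
self-maps of the basis, which are products of those. As [n <= N], the tensor
power is generated under self-maps by a single vector with distinct letters, so
the operator is a unique combination of permutations ([commutant_expansion]),
and the coefficients follow from the orthonormality relations of [U].

Therefore [n! ^ 2] times the expectation of [|c_n| ^ 2] is [n!] times the sum
over [s] of [(fix_k s) ^ 2]. Since [(fix_k s) ^ 2] is the number of invariant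
colourings with [k ^ 2] colours, the orbit-counting lemma evaluates the sum as
[n!] times the number of multisets of size [n] in a set of [k ^ 2] elements,
which is the binomial coefficient. *)

(** * Principal minors *)

(** The rows indexed by [S] come from [B], the others from [A]: choosing a term
of each row of [A + X B] in the multilinear expansion of its determinant. *)
Definition mix_rows (R : Type) (D : nat) (S : {set 'I_D}) (B A : 'M[R]_D) : 'M[R]_D :=
  \matrix_(i, j) if i \in S then B i j else A i j.

(** Expand each factor of the Leibniz formula over the rows that contribute
their ['X]-term. *)
Lemma coef_det_pencil (R : comNzRingType) (D n : nat) (A B : 'M[R]_D) :
  (\det (map_mx polyC A + 'X *: map_mx polyC B))`_n
  = \sum_(S : {set 'I_D} | #|S| == n) \det (mix_rows S B A).
Proof.
have -> : \det (map_mx polyC A + 'X *: map_mx polyC B) =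
    \sum_(S : {set 'I_D}) (\det (mix_rows S B A)) *: 'X^#|S|.
  rewrite /determinant.
  under [RHS]eq_bigr do rewrite scaler_suml.
  rewrite exchange_big /=; apply: eq_bigr => s _.
  under eq_bigr => i _ do rewrite !mxE addrC.
  rewrite bigA_distr mulr_sumr; apply: eq_bigr => S _.
  rewrite -mul_polyC polyCM -mulrA; congr (_ * _).
    by rewrite rmorphXn rmorphN1.
  rewrite (bigID (mem S)) /=.
  under eq_bigr => i iS do rewrite iS.
  under [X in _ * X]eq_bigr => i /negPf iS do rewrite iS.
  rewrite big_split /= prodr_const -mulrA [LHS]mulrC; congr (_ * _).
  rewrite [RHS](rmorph_prod polyC) /= [in RHS](bigID (mem S)) /=; congr (_ * _).
    by apply: eq_bigr => i iS; rewrite mxE iS.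
  by apply: eq_bigr => i /negPf iS; rewrite mxE iS.
rewrite coef_sum [RHS]big_mkcond /=; apply: eq_bigr => S _.
by rewrite coefZ coefXn eq_sym; case: eqP; rewrite ?mulr1 ?mulr0.
Qed.

(** Complementing the set of rows exchanges the two matrices.
For [A = 1] this is the passage from the reversed characteristic polynomial to
the characteristic polynomial. *)
Lemma coef_det_pencil_rev (R : comNzRingType) (D n : nat) (A B : 'M[R]_D) :
  (n <= D)%N ->
  (\det (map_mx polyC A + 'X *: map_mx polyC B))`_(D - n)
  = (\det (map_mx polyC B + 'X *: map_mx polyC A))`_n.
Proof.
move=> nD; rewrite !coef_det_pencil (reindex_inj (@finset.setC_inj _)) /=.
apply: eq_big => [S|S _].
  have := cardsC S; rewrite card_ord => e.
  by rewrite -(eqn_add2l #|S|) e -{1}(subnK nD) addnC eqn_add2r eq_sym.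
by congr (\det _); apply/matrixP=> i j; rewrite !mxE inE; case: (i \in S).
Qed.

(** By induction on [s]: a transposition corrects the value at the new point,
and injectivity of both maps keeps it away from the values already placed. *)
Lemma perm_extends (T : eqType) (T' : finType) (f g : T -> T') (s : seq T) :
  {in s &, injective f} -> {in s &, injective g} ->
  exists p : {perm T'}, {in s, forall x, p (f x) = g x}.
Proof.
elim: s => [|x s IHs] injf injg; first by exists 1%g.
have sub y : y \in s -> y \in x :: s by rewrite inE orbC => ->.
have [||p pE] := IHs; try by move=> y z /sub ys /sub zs; auto.
have [xs|xNs] := boolP (x \in s).
  by exists p => y; rewrite inE => /predU1P[->|] //; apply: pE.
exists (p * tperm (p (f x)) (g x))%g => y; rewrite inE permM.
case/predU1P=> [->|ys]; first by rewrite tpermL.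
have yx : y != x by apply: contraNneq xNs => <-.
rewrite tpermD; first exact: pE.
  rewrite (inj_eq perm_inj) eq_sym; apply: contraNneq yx => fyx.
  by apply/eqP/injf; rewrite ?mem_head ?sub.
rewrite pE // eq_sym; apply: contraNneq yx => gyx.
by apply/eqP/injg; rewrite ?mem_head ?sub.
Qed.

(** After conjugation by a permutation carrying the first [n] indices onto the
image of [f], the matrix becomes block upper triangular with an identity block,
so its determinant is the minor listed by [f]. *)
Lemma det_mix_rows_id (R : comNzRingType) (D n : nat) (M : 'M[R]_D)
    (f : 'I_n -> 'I_D) : injective f ->
  \det (mix_rows [set f a | a : 'I_n] M 1%:M) = \det (\matrix_(a, b) M (f a) (f b)).
Proof.
move=> injf; have [nD|Dn] := leqP n D; last first.
  by have := leq_card f injf; rewrite !card_ord leqNgt Dn.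
have [r eD] : exists r, D = (n + r)%N by exists (D - n)%N; rewrite subnKC.
subst D.
have [p pE] := @perm_extends _ _ (lshift r) f (enum 'I_n)
  (in2W (@lshift_inj n r)) (in2W injf).
have {}pE a : p (lshift r a) = f a by rewrite pE ?mem_enum.
set S := [set f a | a : 'I_n]; set A := mix_rows S M 1%:M.
have SE j : (p j \in S) = (j < n)%N.
  apply/imsetP/idP => [[a _]|jn].
    by rewrite -pE => /perm_inj -> /=.
  by exists (Ordinal jn) => //; rewrite -pE; congr (p _); apply: val_inj.
(* Permuting rows and columns alike multiplies the determinant by a squared sign. *)
transitivity (\det (row_perm p (col_perm p A))).
  rewrite row_permE col_permE !det_mulmx !det_perm odd_permV mulrCA.
  by rewrite -expr2 sqrr_sign mulr1.
have -> : row_perm p (col_perm p A) =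
    block_mx (\matrix_(a, b) M (f a) (f b)) (\matrix_(a, b) M (f a) (p (rshift n b)))
             0 1%:M.
  apply/matrixP => i j; rewrite !mxE SE.
  case: splitP => [a ia|b ib]; rewrite mxE; case: splitP => [c jc|d jd].
  - rewrite mxE -!pE; congr (M (p _) (p _)); exact: val_inj.
  - rewrite mxE -!pE; congr (M (p _) (p _)); exact: val_inj.
  - rewrite !mxE (inj_eq perm_inj).
    by case: eqP => // ij; move: (ltn_ord c); rewrite -jc -ij ib ltnNge leq_addr.
  - rewrite !mxE (inj_eq perm_inj).
    by rewrite -(inj_eq val_inj) /= ib jd eqn_add2l.
by rewrite det_ublock det1 mulr1.
Qed.

(** Each principal minor of size [n] is listed by exactly [n`!] injections,
and a non-injective [f] repeats a row. Summing over all maps, rather than over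
subsets, is what later turns minors into traces on a tensor power. *)
Lemma coef_det_principal (R : comNzRingType) (D n : nat) (M : 'M[R]_D) :
  ((\det (1%:M + 'X *: map_mx polyC M))`_n) *+ n`!
  = \sum_(f : {ffun 'I_n -> 'I_D}) \det (\matrix_(a, b) M (f a) (f b)).
Proof.
rewrite -[1%:M](map_mx1 polyC) coef_det_pencil.
rewrite [RHS](bigID (fun f : {ffun 'I_n -> 'I_D} => injectiveb f)) /=.
rewrite [X in _ = _ + X]big1 ?addr0; last first.
  move=> f /injectivePn[a [b ab fab]].
  by apply: (determinant_alternate ab) => c; rewrite !mxE fab.
rewrite [RHS](partition_big (fun f : {ffun 'I_n -> 'I_D} => [set f a | a : 'I_n])
  (fun S : {set 'I_D} => #|S| == n)) /=; last first.
  by move=> f /injectiveP injf; rewrite card_imset // card_ord.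
rewrite -sumrMnl; apply: eq_bigr => S /eqP cS.
transitivity (\sum_(f : {ffun 'I_n -> 'I_D} | injectiveb f &&
    ([set f a | a : 'I_n] == S)) \det (mix_rows S M 1%:M)); last first.
  by apply: eq_bigr => f /andP[/injectiveP injf /eqP <-]; exact: det_mix_rows_id.
rewrite sumr_const; congr (_ *+ _).
rewrite -[RHS]/(#|[pred f : {ffun 'I_n -> 'I_D} |
  injectiveb f && ([set f a | a : 'I_n] == S)]|).
have := card_inj_ffuns_on 'I_n (mem S).
rewrite card_ord cS ffactnn => <-; apply: eq_card => f; rewrite !inE andbC.
have [/injectiveP injf|] := boolP (injectiveb f); rewrite ?andbF ?andbT //.
rewrite /= eqEcard card_imset // cS card_ord leqnn andbT.
apply/forallP/fintype.subsetP => [on i /imsetP[a _ ->]|sub a]; first exact: on.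
by apply: sub; rewrite imset_f.
Qed.

(** * The permutation expansion of powers of a characteristic polynomial *)

Local Notation "A *t B" := (tensmx A B) (at level 40, left associativity).

Lemma det_castmx (R : comNzRingType) (m n : nat) (e1 e2 : m = n) (A : 'M[R]_m) :
  \det (castmx (e1, e2) A) = \det A.
Proof. by case: n / e1 e2 => e2; rewrite castmx_id. Qed.

Lemma det_tens1mx (R : comNzRingType) (k N : nat) (A : 'M[R]_N) :
  \det ((1%:M : 'M[R]_k) *t A) = \det A ^+ k.
Proof.
elim: k => [|k IHk]; first by rewrite expr0 [LHS]det_mx00.
rewrite exprS -IHk (scalar_mx_block 1 k 1 : 1%:M = _ :> 'M[R]_k.+1).
rewrite tens_block_mx det_castmx !tens0mx det_ublock; congr (_ * _).
by rewrite tens_scalar1mx det_castmx.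
Qed.

(** A map to the index set of a Kronecker product is a colouring together with
a map to the index set of the second factor. *)
Definition tens_ffun (n p q : nat) (u : {ffun 'I_n -> 'I_p} * {ffun 'I_n -> 'I_q}) :
  {ffun 'I_n -> 'I_(p * q)} := [ffun a => mxtens_index (u.1 a, u.2 a)].

Lemma tens_ffun_bij (n p q : nat) : bijective (@tens_ffun n p q).
Proof.
exists (fun f : {ffun 'I_n -> 'I_(p * q)} =>
  ([ffun a => (mxtens_unindex (f a)).1] : {ffun 'I_n -> 'I_p},
   [ffun a => (mxtens_unindex (f a)).2] : {ffun 'I_n -> 'I_q})) => [[c g]|f].
  by congr (_, _); apply/ffunP=> a; rewrite !ffunE mxtens_indexK.
by apply/ffunP=> a; rewrite !ffunE -surjective_pairing mxtens_unindexK.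
Qed.

Lemma det_pencil_tens (R : comNzRingType) (k N : nat) (A B : 'M[R]_N) :
  \det (map_mx polyC ((1%:M : 'M[R]_k) *t A) + 'X *: map_mx polyC ((1%:M : 'M[R]_k) *t B))
  = \det (map_mx polyC A + 'X *: map_mx polyC B) ^+ k.
Proof.
rewrite -det_tens1mx; congr (\det _); apply/matrixP=> i j.
case: (mxtens_indexP i) => i0 i1; case: (mxtens_indexP j) => j0 j1.
rewrite !mxE !mxtens_indexK /= !rmorphM /= rmorphMn /= polyC1.
by rewrite mulrDr mulrCA.
Qed.

Lemma tens11mx (R : comNzRingType) (k N : nat) :
  (1%:M : 'M[R]_k) *t (1%:M : 'M[R]_N) = 1%:M.
Proof.
apply/matrixP=> i j; case: (mxtens_indexP i) => i0 i1; case: (mxtens_indexP j) => j0 j1.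
rewrite tensmxE !mxE (inj_eq (can_inj (@mxtens_indexK _ _))) -pair_eqE /= -natrM.
by rewrite mulnb.
Qed.

Definition card_fixed_colorings (n k : nat) (s : {perm 'I_n}) : nat :=
  #|[set c : {ffun 'I_n -> 'I_k} | [forall a, c (s a) == c a]]|.

(** The trace of the [n]-th tensor power of [U] composed with the permutation
[s] of the tensor factors, that is, the power sum of [U] of cycle type [s]. *)
Definition perm_trace (R : comNzRingType) (n N : nat) (U : 'M[R]_N) (s : {perm 'I_n}) : R :=
  \sum_(g : {ffun 'I_n -> 'I_N}) \prod_a U (g a) (g (s a)).

(** The [k]-th power is the determinant attached to the Kronecker product of
the identity of size [k] with [U]. In its principal minors the identity factor
forces the colours to be constant along the cycles of [s], which produces the
weight [card_fixed_colorings k s]. *)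
Lemma coef_det_exp (R : comNzRingType) (n k N : nat) (U : 'M[R]_N) :
  ((\det (1%:M + 'X *: map_mx polyC U) ^+ k)`_n) *+ n`!
  = \sum_(s : 'S_n) (-1) ^+ s * (card_fixed_colorings k s)%:R * perm_trace U s.
Proof.
rewrite -[1%:M in LHS](map_mx1 polyC) -det_pencil_tens tens11mx map_mx1.
rewrite coef_det_principal /determinant exchange_big /=.
apply: eq_bigr => s _; rewrite -mulr_sumr -mulrA; congr (_ * _).
rewrite (reindex (@tens_ffun n k N)) /=; last exact/onW_bij/tens_ffun_bij.
rewrite -(pair_bigA _ (fun c g => \prod_a (\matrix_(a, b)
  ((1%:M : 'M[R]_k) *t U) (tens_ffun (c, g) a) (tens_ffun (c, g) b)) a (s a))) /=.
rewrite /card_fixed_colorings -sum1_card natr_sum mulr_suml [RHS]big_mkcond /=.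
apply: eq_bigr => c _; rewrite inE mul1r.
transitivity (\sum_(g : {ffun 'I_n -> 'I_N})
    (\prod_a (c (s a) == c a)%:R) * \prod_a U (g a) (g (s a))).
  apply: eq_bigr => g _; rewrite -big_split /=; apply: eq_bigr => a _.
  by rewrite mxE !ffunE /= tensmxE mxE eq_sym.
rewrite -mulr_sumr; case: ifP => [/forallP cs|/forallPn[a ca]].
  by rewrite big1 ?mul1r // => a _; rewrite cs.
by rewrite (bigD1 a) //= (negPf ca) !mul0r.
Qed.

Lemma sum_prod_coef (R : comNzRingType) (k N m : nat) (p : {poly R}) :
  (size p <= N.+1)%N ->
  \sum_(j : {ffun 'I_k -> 'I_N.+1} | (\sum_(i < k) j i)%N == m) \prod_(i < k) p`_(j i)
  = (p ^+ k)`_m.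
Proof.
move=> sp; have pE : p = \sum_(j < N.+1) p`_j *: 'X^j.
  rewrite -poly_def; apply/polyP=> i; rewrite coef_poly; case: ltnP => // Ni.
  by rewrite nth_default // (leq_trans sp).
rewrite -[in RHS](card_ord k) -prodr_const {2}pE bigA_distr_bigA coef_sum /=.
rewrite [LHS]big_mkcond /=; apply: eq_bigr => j _.
under [in RHS]eq_bigr do rewrite -mul_polyC.
rewrite big_split /= -rmorph_prod /= prodrXr coefCM coefXn eq_sym.
by case: eqP; rewrite ?mulr1 ?mulr0.
Qed.

Lemma size_det_secular (R : comNzRingType) (N : nat) (U : 'M[R]_N) :
  (size (\det (1%:M + 'X *: map_mx polyC U)) <= N.+1)%N.
Proof.
apply/leq_sizeP => j Nj; rewrite -[1%:M](map_mx1 polyC) coef_det_pencil big1 // => S /eqP cS.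
by have := max_card (mem S); rewrite card_ord cS leqNgt Nj.
Qed.

Lemma secular_sumE (R : comNzRingType) (k N m : nat) (U : 'M[R]_N) :
  \sum_(j : {ffun 'I_k -> 'I_N.+1} | (\sum_(i < k) j i)%N == m)
     \prod_(i < k) secular_coef U (j i)
  = (\det (1%:M + 'X *: map_mx polyC U) ^+ k)`_m.
Proof. exact/sum_prod_coef/size_det_secular. Qed.

(** * Operators commuting with the tensor powers of all unitary matrices *)

Definition precomp (n : nat) (T : finType) (f : {ffun 'I_n -> T}) (s : 'S_n) :
  {ffun 'I_n -> T} := [ffun a => f (s a)].

Lemma precompM (n : nat) (T : finType) (f : {ffun 'I_n -> T}) (s t : 'S_n) :
  precomp (precomp f s) t = precomp f (t * s)%g.
Proof. by apply/ffunP=> a; rewrite !ffunE permM. Qed.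

Lemma precomp1 (n : nat) (T : finType) (f : {ffun 'I_n -> T}) : precomp f 1%g = f.
Proof. by apply/ffunP=> a; rewrite ffunE perm1. Qed.

Lemma precompK (n : nat) (T : finType) (s : 'S_n) :
  cancel (fun f : {ffun 'I_n -> T} => precomp f s) (fun f => precomp f s^-1%g).
Proof. by move=> f; rewrite precompM mulVg precomp1. Qed.

Lemma precompVK (n : nat) (T : finType) (s : 'S_n) :
  cancel (fun f : {ffun 'I_n -> T} => precomp f s^-1%g) (fun f => precomp f s).
Proof. by move=> f; rewrite precompM mulgV precomp1. Qed.

Lemma precomp_inj (n : nat) (T : finType) (f : {ffun 'I_n -> T}) :
  injective f -> injective (precomp f).
Proof.
by move=> injf s t /ffunP st; apply/permP=> a; apply: injf; have := st a; rewrite !ffunE.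
Qed.

Lemma same_fibers_precomp (n : nat) (T : finType) (f h : {ffun 'I_n -> T}) :
  (forall i, #|[set a | f a == i]| = #|[set a | h a == i]|) ->
  exists s, f = precomp h s.
Proof.
move=> fh; have cnt (g : {ffun 'I_n -> T}) i :
    count_mem i [tuple g a | a < n] = #|[set a | g a == i]|.
  rewrite -sum1_count /= big_map big_enum_cond -sum1_card.
  by apply: eq_bigl => a; rewrite !inE.
have /tuple_permP[s sE] : perm_eq [tuple f a | a < n] [tuple h a | a < n].
  by apply/allP => i _; rewrite /= !cnt fh.
exists s; apply/ffunP=> a; rewrite ffunE.
by have := congr1 (fun t => tnth t a) (val_inj sE); rewrite !tnth_mktuple.
Qed.

Section TensorPower.
Variables (R : comNzRingType) (n N : nat).
Implicit Types (V W : 'M[R]_N) (f g h : {ffun 'I_n -> 'I_N}).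

(** The matrix coefficients of the [n]-th tensor power of [V], in the basis
indexed by maps from ['I_n] to ['I_N]. *)
Definition tpow V f g : R := \prod_a V (f a) (g a).

Lemma tpowM V W f g : tpow (V *m W) f g = \sum_h tpow V f h * tpow W h g.
Proof.
rewrite /tpow; under eq_bigr do rewrite mxE.
by rewrite bigA_distr_bigA; apply: eq_bigr => h _; rewrite big_split.
Qed.

Lemma prod_nat_eq (f g : {ffun 'I_n -> 'I_N}) :
  \prod_a (f a == g a)%:R = (f == g)%:R :> R.
Proof.
have [->|] := eqVneq f g; first by rewrite big1 // => a _; rewrite eqxx.
move=> fg; have [a /negPf fga] : exists a, f a != g a.
  apply/existsP; apply: contraNT fg => /existsPn fg.
  by apply/eqP/ffunP => a; apply/eqP; rewrite -[_ == _]negbK fg.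
by rewrite (bigD1 a) //= fga mul0r.
Qed.

Lemma tpow1 f g : tpow 1%:M f g = (f == g)%:R.
Proof. by rewrite -prod_nat_eq; apply: eq_bigr => a _; rewrite mxE. Qed.

Lemma tpow_precomp V f g s : tpow V (precomp f s) (precomp g s) = tpow V f g.
Proof.
rewrite [RHS](reindex_inj (@perm_inj _ s)).
by apply: eq_bigr => a _; rewrite !ffunE.
Qed.

(** The kernel [X] is an operator on the [n]-th tensor power, given by its
matrix coefficients. *)
Definition tpow_commute (X : {ffun 'I_n -> 'I_N} -> {ffun 'I_n -> 'I_N} -> R) V : Prop :=
  forall f g, \sum_h X f h * tpow V h g = \sum_h tpow V f h * X h g.

Lemma tpow_commuteM X V W : tpow_commute X V -> tpow_commute X W -> tpow_commute X (V *m W).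
Proof.
move=> XV XW f g.
transitivity (\sum_l (\sum_h X f h * tpow V h l) * tpow W l g).
  under eq_bigr do rewrite tpowM mulr_sumr.
  rewrite exchange_big; apply: eq_bigr => l _.
  by rewrite mulr_suml; apply: eq_bigr => h _; rewrite mulrA.
under eq_bigr do rewrite XV mulr_suml.
rewrite exchange_big /=.
under [RHS]eq_bigr do rewrite tpowM mulr_suml.
rewrite [RHS]exchange_big; apply: eq_bigr => h _.
under eq_bigr do rewrite -mulrA.
rewrite -mulr_sumr XW mulr_sumr.
by apply: eq_bigr => l _; rewrite mulrA.
Qed.

Lemma tpow_diag (d : 'rV[R]_N) f g :
  tpow (diag_mx d) f g = (f == g)%:R * \prod_a d 0 (g a).
Proof.
rewrite -prod_nat_eq -big_split; apply: eq_bigr => a _; rewrite mxE /=.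
by case: eqP => [->|]; rewrite ?mul1r ?mul0r.
Qed.

Lemma tpow_commute_diagE X (d : 'rV[R]_N) :
  tpow_commute X (diag_mx d) <->
  forall f g, X f g * \prod_a d 0 (g a) = \prod_a d 0 (f a) * X f g.
Proof.
have L f g : \sum_h X f h * tpow (diag_mx d) h g = X f g * \prod_a d 0 (g a).
  rewrite (bigD1 g) //= big1 ?addr0 => [|h /negPf hg]; rewrite tpow_diag.
    by rewrite eqxx mul1r.
  by rewrite hg mul0r mulr0.
have L' f g : \sum_h tpow (diag_mx d) f h * X h g = \prod_a d 0 (f a) * X f g.
  rewrite (bigD1 f) //= big1 ?addr0 => [|h /negPf hg]; rewrite tpow_diag.
    by rewrite eqxx mul1r.
  by rewrite eq_sym hg !mul0r.
by split=> H f g; have := H f g; rewrite L L'.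
Qed.

End TensorPower.

Definition fun_mx (R : comNzRingType) (N : nat) (phi : 'I_N -> 'I_N) : 'M[R]_N :=
  \matrix_(b, a) (b == phi a)%:R.

Lemma tpow_fun_mx (R : comNzRingType) (n N : nat) (phi : 'I_N -> 'I_N)
    (f g : {ffun 'I_n -> 'I_N}) :
  tpow (fun_mx R phi) f g = (f == [ffun a => phi (g a)])%:R.
Proof. by rewrite -prod_nat_eq; apply: eq_bigr => a _; rewrite mxE ffunE. Qed.

Section Commutant.
Local Open Scope sesquilinear_scope.
Variables (C : numClosedFieldType) (n N : nat).
Variable X : {ffun 'I_n -> 'I_N} -> {ffun 'I_n -> 'I_N} -> C.
Hypothesis X_unitary : forall V : 'M[C]_N, V \is unitarymx -> tpow_commute X V.

(** Commuting with the diagonal matrix that has [t] at [i] and [1] elsewhere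
equates two powers of [t], for every [t] of modulus one. Were the exponents
different by [d], a [d]-th root of [-1] would contradict this. Hence [X] only
connects maps with equal fibre sizes. *)
Lemma commutant_weight f g : X f g != 0 -> exists s, f = precomp g s.
Proof.
move=> Xfg; apply: same_fibers_precomp => i.
have key (t : C) : `|t| = 1 ->
    t ^+ #|[set a | f a == i]| = t ^+ #|[set a | g a == i]|.
  move=> t1; pose d : 'rV[C]_N := \row_j (if j == i then t else 1).
  have dE (h : {ffun 'I_n -> 'I_N}) : \prod_a d 0 (h a) = t ^+ #|[set a | h a == i]|.
    rewrite -prodr_const [RHS]big_mkcond; apply: eq_bigr => a _.
    by rewrite mxE inE.
  have /tpow_commute_diagE/(_ f g) : tpow_commute X (diag_mx d).
    apply/X_unitary/unitarymxP/matrixP => j l; rewrite !mxE (bigD1 j) //=.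
    rewrite !mxE eqxx mulr1n big1 => [|m /negPf mj]; last first.
      by rewrite !mxE (eq_sym j m) mj mulr0n mul0r.
    rewrite addr0; case: (eqVneq l j) => [->|_]; last by rewrite mulr0n rmorph0 mulr0.
    rewrite mulr1n -normCK; case: ifP; rewrite ?t1 ?normr1 expr1n //.
  by rewrite !dE mulrC => /(mulIf Xfg) <-.
have absurd p q : (p < q)%N -> (forall t : C, `|t| = 1 -> t ^+ p = t ^+ q) -> False.
  move=> pq H; pose d := (q - p)%N; have d0 : (0 < d)%N by rewrite subn_gt0.
  (* The modulus of a root of -1 is one, so it is an admissible value of t. *)
  have rt : (d.-root (-1) : C) ^+ d = -1 by rewrite rootCK.
  have r1 : `|d.-root (-1 : C)| = 1.
    by apply/eqP; rewrite -(pexpr_eq1 d0) // -normrX rt normrN1.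
  have rp0 : (d.-root (-1) : C) ^+ p != 0.
    by rewrite expf_neq0 // -normr_eq0 r1 oner_neq0.
  have := H _ r1; rewrite -(subnK (ltnW pq)) exprD rt mulN1r => /eqP.
  by rewrite -subr_eq0 opprK -mulr2n mulrn_eq0 (negPf rp0).
case: (ltngtP #|[set a | f a == i]| #|[set a | g a == i]|) => // lt; exfalso.
  by apply: (absurd _ _ lt) => t /key.
by apply: (absurd _ _ lt) => t /key.
Qed.

(** Preserving weights is all that a diagonal matrix asks for: this is the
step from the unitary group to matrices that need not be unitary. *)
Lemma commutant_diag (d : 'rV[C]_N) : tpow_commute X (diag_mx d).
Proof.
apply/tpow_commute_diagE => f g.
have [->|/commutant_weight[s ->]] := eqVneq (X f g) 0; first by rewrite mul0r mulr0.
rewrite mulrC; congr (_ * _); rewrite (reindex_inj (@perm_inj _ s)).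
by apply: eq_bigr => a _; rewrite ffunE.
Qed.

Lemma commutant_normal (V : 'M[C]_N) : V \is normalmx -> tpow_commute X V.
Proof.
move/orthomx_spectralP ->; apply: tpow_commuteM.
  apply: tpow_commuteM; last exact: commutant_diag.
  by apply: X_unitary; rewrite invmx_unitary ?trmxC_unitary spectral_unitarymx.
exact/X_unitary/spectral_unitarymx.
Qed.

Lemma commutant_perm (s : 'S_N) : tpow_commute X (fun_mx C s).
Proof.
apply/X_unitary/unitarymxP/matrixP => i j; rewrite !mxE (bigD1 ((s^-1)%g i)) //=.
rewrite !mxE permKV eqxx mul1r conjC_nat big1 ?addr0 1?eq_sym // => l.
by rewrite !mxE -(inj_eq (@perm_inj _ s)) permKV eq_sym => /negPf ->; rewrite mul0r.
Qed.

(** The Gram matrix [E] of the fibres of [e] is real symmetric, hence normal,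
and a diagonal projection keeps one row per fibre. *)
Lemma commutant_idempotent (e : 'I_N -> 'I_N) :
  (forall i, e (e i) = e i) -> tpow_commute X (fun_mx C e).
Proof.
move=> ee; pose D : 'rV[C]_N := \row_j (e j == j)%:R.
pose E : 'M[C]_N := \matrix_(i, j) (e i == e j)%:R.
have -> : fun_mx C e = diag_mx D *m E.
  apply/matrixP => i j; rewrite mul_diag_mx !mxE -natrM mulnb; congr (_%:R).
  congr nat_of_bool; apply/eqP/andP => [->|[/eqP ei /eqP eij]]; last by rewrite -ei eij.
  by rewrite ee !eqxx.
apply: tpow_commuteM; first exact: commutant_diag.
apply/commutant_normal/symmetric_normalmx.
  by rewrite is_hermitianmxE expr0 scale1r; apply/eqP/matrixP => i j; rewrite !mxE eq_sym.
by apply/mxOverP => i j; rewrite mxE realn.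
Qed.

(** Every self-map is an idempotent choosing one representative per fibre,
followed by a permutation moving each representative to the common value. *)
Lemma commutant_fun (phi : 'I_N -> 'I_N) : tpow_commute X (fun_mx C phi).
Proof.
pose rep b := odflt b [pick i | phi i == b].
have repK i : phi (rep (phi i)) = phi i.
  by rewrite /rep; case: pickP => [j /eqP //|/(_ i)]; rewrite eqxx.
(* On the values of phi, rep is injective because phi undoes it. *)
have [||p pE] := @perm_extends _ _ rep id (codom phi).
- by move=> _ _ /codomP[i ->] /codomP[j ->] /(congr1 phi); rewrite !repK.
- exact: in2W.
have -> : fun_mx C phi = fun_mx C p *m fun_mx C (rep \o phi).
  apply/matrixP => i j; rewrite !mxE (bigD1 (rep (phi j))) //= big1 => [|l /negPf lj].
    by rewrite !mxE eqxx mulr1 addr0 pE ?codom_f.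
  by rewrite !mxE lj mulr0.
apply: tpow_commuteM; first exact: commutant_perm.
by apply: commutant_idempotent => i /=; rewrite repK.
Qed.

(** The easy case of Schur-Weyl duality, available when there is an injection
[f0], i.e. [n <= N]. The vector [f0] generates the whole tensor power: [h] is
its image under a function matrix, with which [X] commutes, and by weights [X]
sends [f0] to a combination of its rearrangements. *)
Lemma commutant_expansion (f0 h f : {ffun 'I_n -> 'I_N}) : injective f0 ->
  X f h = \sum_(s : 'S_n) (f == precomp h s)%:R * X (precomp f0 s) f0.
Proof.
move=> inj0; pose phi i := if [pick a | f0 a == i] is Some a then h a else i.
have phiE a : phi (f0 a) = h a.
  by rewrite /phi; case: pickP => [b /eqP/inj0 -> //|/(_ a)]; rewrite eqxx.
have := commutant_fun phi f f0.
rewrite (bigD1 h) //= big1 => [|g gh]; last first.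
  rewrite tpow_fun_mx (_ : [ffun a => _] = h) ?(negPf gh) ?mulr0 //.
  by apply/ffunP=> a; rewrite ffunE phiE.
rewrite tpow_fun_mx (_ : [ffun a => _] = h) ?eqxx ?mulr1 ?addr0; last first.
  by apply/ffunP=> a; rewrite ffunE phiE.
move=> ->; rewrite (bigID (mem (codom (precomp f0)))) /= [X in _ + X]big1 => [|g gN].
  have U : uniq (codom (precomp f0)) by apply/injectiveP/precomp_inj.
  rewrite addr0 -[LHS](big_uniq _ U).
  rewrite codomE big_map big_enum; apply: eq_bigr => s _.
  rewrite tpow_fun_mx; congr ((f == _)%:R * _).
  by apply/ffunP=> a; rewrite !ffunE phiE.
have [->|/commutant_weight[s gE]] := eqVneq (X g f0) 0; first by rewrite mulr0.
by rewrite gE codom_f in gN.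
Qed.

End Commutant.

Section UnitaryOrthogonality.
Local Open Scope sesquilinear_scope.
Variables (C : numClosedFieldType) (n N : nat).
Implicit Types (V : 'M[C]_N) (f g h : {ffun 'I_n -> 'I_N}).

Lemma tpow_adjoint V f g : tpow (V ^t*) f g = (tpow V g f)^*.
Proof. by rewrite /tpow rmorph_prod; apply: eq_bigr => a _; rewrite !mxE. Qed.

Lemma tpow_row_orthonormal V f h : V \is unitarymx ->
  \sum_g tpow V f g * (tpow V h g)^* = (f == h)%:R.
Proof.
move=> /unitarymxP VV; rewrite -(tpow1 C) -VV tpowM.
by apply: eq_bigr => g _; rewrite tpow_adjoint.
Qed.

Lemma tpow_col_orthonormal V f h : V \is unitarymx ->
  \sum_g (tpow V g f)^* * tpow V g h = (f == h)%:R.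
Proof.
rewrite -trmxC_unitary => /unitarymxP; rewrite trmxCK => VV.
rewrite -(tpow1 C) -VV tpowM.
by apply: eq_bigr => g _; rewrite tpow_adjoint.
Qed.

End UnitaryOrthogonality.

(** * Colourings fixed by a permutation *)

(** Colourings with [p * q] colours are pairs of colourings. *)
Lemma card_fixed_coloringsM (n p q : nat) (s : 'S_n) :
  (card_fixed_colorings p s * card_fixed_colorings q s)%N = card_fixed_colorings (p * q) s.
Proof.
rewrite /card_fixed_colorings -cardsX -(card_imset _ (bij_inj (@tens_ffun_bij n p q))).
have [g gK Kg] := @tens_ffun_bij n p q.
apply: eq_card => f; rewrite -[f]Kg.
rewrite mem_imset; last exact: bij_inj (@tens_ffun_bij n p q).
case: (g f) => c d; rewrite !inE /=.
apply/andP/forallP => [[/forallP cs /forallP ds] a|H].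
  by rewrite !ffunE /= (eqP (cs a)) (eqP (ds a)).
have {}H a : (c (s a), d (s a)) = (c a, d a).
  by apply: (can_inj (@mxtens_indexK _ _)); have := H a; rewrite !ffunE => /eqP.
by split; apply/forallP => a; case: (H a) => Hc Hd; rewrite ?Hc ?Hd.
Qed.

Lemma card_fixed_coloringsJ (n k : nat) (s t : 'S_n) :
  card_fixed_colorings k (s ^ t)%g = card_fixed_colorings k s.
Proof.
have injt := can_inj (@precompK n 'I_k t); rewrite /card_fixed_colorings -(card_imset _ injt).
have fixE (c : {ffun 'I_n -> 'I_k}) (u : 'S_n) : [forall a, c (u a) == c a] = (precomp c u == c).
  apply/forallP/eqP => [cu|cu a]; first by apply/ffunP=> a; rewrite ffunE (eqP (cu a)).
  by apply/eqP; rewrite -[in RHS]cu ffunE.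
apply: eq_card => c; rewrite -[in LHS](precompVK t c) (mem_imset _ _ injt).
rewrite !inE !fixE precompM conjgE mulgA mulgK -precompM.
exact: inj_eq (can_inj (@precompVK n _ t)) _ _.
Qed.

Section Burnside.
Variables (n K : nat).

Lemma perm_color_act : is_action [set: 'S_n]
  (fun (c : {ffun 'I_n -> 'I_K.+1}) (s : 'S_n) => precomp c s^-1%g).
Proof.
apply: is_total_action => [c|c s t]; first by rewrite invg1 precomp1.
by rewrite precompM invMg.
Qed.

(** The inverse makes precomposition a right action. *)
Definition color_act := Action perm_color_act.

(** Each orbit has exactly one nondecreasing member, so orbits are counted by
multisets. *)
Lemma card_color_orbits :
  #|orbit color_act [set: 'S_n] @: [set: {ffun 'I_n -> 'I_K.+1}]| = 'C(n + K, n).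
Proof.
rewrite -card_sorted_tuples.
pose F (t : n.-tuple 'I_K.+1) := orbit color_act [set: 'S_n] [ffun a => tnth t a].
rewrite -(card_in_imset (f := F)) /=; last first.
  move=> t u; rewrite !inE => ts us /eqP; rewrite orbit_eq_mem => /orbitP[s _ su].
  apply: val_inj; apply: (inj_map val_inj); apply: (sorted_eq leq_trans anti_leq ts us).
  apply: perm_map; apply/tuple_permP; exists (s^-1)%g.
  apply: (congr1 val); apply: eq_from_tnth => a; rewrite tnth_mktuple.
  by have /ffunP/(_ a) := su; rewrite /= !ffunE => ->.
congr #|pred_of_set _|; apply/setP => O; apply/imsetP/imsetP => [[c _ ->]|[t _ ->]]; last first.
  by exists [ffun a => tnth t a]; rewrite ?inE.
pose t0 := [tuple c a | a < n].
have ss : size (sort (relpre val leq) t0) == n by rewrite size_sort size_tuple.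
exists (Tuple ss).
  by rewrite inE /= sorted_map; apply: sort_sorted => x y; apply: leq_total.
apply/eqP; rewrite orbit_eq_mem.
have /tuple_permP[s sE] : perm_eq t0 (Tuple ss) by rewrite /= perm_sym perm_sort.
apply/orbitP; exists s^-1%g; rewrite ?inE //=.
apply/ffunP=> a; rewrite !ffunE invgK.
by have := congr1 (fun t => tnth t a) (val_inj sE); rewrite !tnth_mktuple.
Qed.

(** The orbit-counting lemma for permutations of [n] places acting on
colourings. *)
Lemma sum_card_fixed_colorings :
  (\sum_(s : 'S_n) card_fixed_colorings K.+1 s = 'C(n + K, n) * n`!)%N.
Proof.
have := @Frobenius_Cauchy _ _ _ color_act [set: 'S_n]%G [set: {ffun 'I_n -> 'I_K.+1}].
rewrite card_color_orbits /= cardsT card_Sn => <-; last first.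
  by apply/actsP => s _ c; rewrite !inE.
apply: eq_big => [s|s _]; first by rewrite inE.
rewrite /card_fixed_colorings; apply: eq_card => c; rewrite !inE finset.sub1set inE /=.
apply/forallP/eqP => [cu|cu a].
  by apply/ffunP=> a; rewrite ffunE -(eqP (cu _)) permKV.
by apply/eqP; rewrite -[in LHS]cu ffunE permK.
Qed.

End Burnside.

(** * Expectations of bounded complex random variables *)

Lemma ReD (R : realType) (x y : R[i]) : complex.Re (x + y) = complex.Re x + complex.Re y.
Proof. by case: x y => ? ? []. Qed.
Lemma ImD (R : realType) (x y : R[i]) : complex.Im (x + y) = complex.Im x + complex.Im y.
Proof. by case: x y => ? ? []. Qed.
Lemma ReM (R : realType) (x y : R[i]) :
  complex.Re (x * y) = complex.Re x * complex.Re y - complex.Im x * complex.Im y.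
Proof. by case: x y => ? ? []. Qed.
Lemma ImM (R : realType) (x y : R[i]) :
  complex.Im (x * y) = complex.Re x * complex.Im y + complex.Im x * complex.Re y.
Proof. by case: x y => ? ? []. Qed.

Section Expectation.
Local Open Scope classical_set_scope.
Context d (T : measurableType d) (R : realType) (P : probability T R).
Implicit Types (f g : T -> R[i]) (u v : T -> R).

Definition bounded_mfun u : Prop :=
  measurable_fun setT u /\ exists M : R, forall x, `|u x| <= M.

Definition bounded_cmfun f : Prop :=
  bounded_mfun (fun x => complex.Re (f x)) /\ bounded_mfun (fun x => complex.Im (f x)).

Lemma bounded_mfun_cst (c : R) : bounded_mfun (fun=> c).
Proof. by split; [exact: measurable_cst|exists `|c|]. Qed.

Lemma bounded_mfunD u v : bounded_mfun u -> bounded_mfun v ->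
  bounded_mfun (fun x => u x + v x).
Proof.
move=> [mu [M uM]] [mv [K vK]]; split; first exact: measurable_funD.
exists (M + K) => x; exact: le_trans (ler_normD _ _) (lerD (uM x) (vK x)).
Qed.

Lemma bounded_mfunM u v : bounded_mfun u -> bounded_mfun v ->
  bounded_mfun (fun x => u x * v x).
Proof.
move=> [mu [M uM]] [mv [K vK]]; split; first exact: measurable_funM.
by exists (M * K) => x; rewrite normrM ler_pM.
Qed.

Lemma bounded_mfunN u : bounded_mfun u -> bounded_mfun (fun x => - u x).
Proof.
move=> [mu [M uM]]; split; first exact: measurableT_comp.
by exists M => x; rewrite normrN.
Qed.

Lemma bounded_mfun_integrable u : bounded_mfun u -> P.-integrable setT (EFin \o u).
Proof.
move=> [mu [M uM]]; apply: measurable_bounded_integrable => //.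
  by rewrite [X in (X < _)%E](@probability_setT _ _ _ P) ltry.
exists M; split; first exact: num_real.
by move=> K MK x _; apply: le_trans (uM x) (ltW MK).
Qed.

Lemma bounded_cmfun_cst (c : R[i]) : bounded_cmfun (fun=> c).
Proof. by split; exact: bounded_mfun_cst. Qed.

Lemma bounded_cmfunD f g : bounded_cmfun f -> bounded_cmfun g ->
  bounded_cmfun (fun x => f x + g x).
Proof.
move=> [rf jf] [rg jg]; split; [under eq_fun do rewrite ReD|under eq_fun do rewrite ImD];
  exact: bounded_mfunD.
Qed.

Lemma bounded_cmfunM f g : bounded_cmfun f -> bounded_cmfun g ->
  bounded_cmfun (fun x => f x * g x).
Proof.
move=> [rf jf] [rg jg]; split; [under eq_fun do rewrite ReM|under eq_fun do rewrite ImM];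
  apply: bounded_mfunD; rewrite ?[X in bounded_mfun X]/=; try exact: bounded_mfunM.
by apply: bounded_mfunN; exact: bounded_mfunM.
Qed.

Lemma bounded_cmfun_conj f : bounded_cmfun f -> bounded_cmfun (fun x => (f x)^*).
Proof.
move=> [rf jf]; split.
  by rewrite (_ : (fun _ => _) = (fun x => complex.Re (f x))) //; apply/funext=> x; case: (f x).
rewrite (_ : (fun _ => _) = (fun x => - complex.Im (f x))); first exact: bounded_mfunN.
by apply/funext=> x; case: (f x).
Qed.

Lemma bounded_cmfun_sum (I : Type) (s : seq I) (Q : pred I) (F : I -> T -> R[i]) :
  (forall i, Q i -> bounded_cmfun (F i)) -> bounded_cmfun (fun x => \sum_(i <- s | Q i) F i x).
Proof.
move=> bF; elim: s => [|i s IHs].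
  by under eq_fun do rewrite big_nil; exact: bounded_cmfun_cst.
have [Qi|/negPf Qi] := boolP (Q i); under eq_fun do rewrite big_cons Qi.
  by apply: bounded_cmfunD => //; exact: bF.
exact: IHs.
Qed.

Lemma bounded_cmfun_prod (I : Type) (s : seq I) (Q : pred I) (F : I -> T -> R[i]) :
  (forall i, Q i -> bounded_cmfun (F i)) -> bounded_cmfun (fun x => \prod_(i <- s | Q i) F i x).
Proof.
move=> bF; elim: s => [|i s IHs].
  by under eq_fun do rewrite big_nil; exact: bounded_cmfun_cst.
have [Qi|/negPf Qi] := boolP (Q i); under eq_fun do rewrite big_cons Qi.
  by apply: bounded_cmfunM => //; exact: bF.
exact: IHs.
Qed.

Definition expectC f : R[i] :=
  Complex (\int[P]_x complex.Re (f x)) (\int[P]_x complex.Im (f x)).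

Lemma expectC_cst (c : R[i]) : expectC (fun=> c) = c.
Proof.
by rewrite /expectC !Rintegral_cst //= probability_setT !mulr1; case: c.
Qed.

Lemma expectCD f g : bounded_cmfun f -> bounded_cmfun g ->
  expectC (fun x => f x + g x) = expectC f + expectC g.
Proof.
move=> [rf jf] [rg jg]; rewrite /expectC.
under eq_Rintegral do rewrite ReD.
under [X in Complex _ X]eq_Rintegral do rewrite ImD.
by rewrite !RintegralD //; apply: bounded_mfun_integrable.
Qed.

Lemma expectCZ (c : R[i]) f : bounded_cmfun f -> expectC (fun x => c * f x) = c * expectC f.
Proof.
move=> [rf jf]; case: c => a b.
rewrite /expectC; under eq_Rintegral do rewrite ReM.
under [X in Complex _ X]eq_Rintegral do rewrite ImM.
have bZ (r : R) u : bounded_mfun u -> bounded_mfun (fun x => r * u x).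
  by apply: bounded_mfunM; exact: bounded_mfun_cst.
rewrite /= RintegralB ?RintegralD ?RintegralZl //;
  apply: bounded_mfun_integrable => //; exact: bZ.
Qed.

Lemma expectC_sum (I : Type) (s : seq I) (Q : pred I) (F : I -> T -> R[i]) :
  (forall i, bounded_cmfun (F i)) ->
  expectC (fun x => \sum_(i <- s | Q i) F i x) = \sum_(i <- s | Q i) expectC (F i).
Proof.
move=> bF; elim: s => [|i s IHs].
  rewrite big_nil -[RHS](expectC_cst 0); congr expectC; apply/funext=> x.
  by rewrite big_nil.
rewrite big_cons; case: ifP => Qi; last first.
  by rewrite -IHs; congr expectC; apply/funext=> x; rewrite big_cons Qi.
rewrite -IHs -expectCD //; last by apply: bounded_cmfun_sum.
by congr expectC; apply/funext=> x; rewrite big_cons Qi.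
Qed.

Lemma integral_normc_sqr f : bounded_cmfun f ->
  (\int[P]_x ((Normc.normc (f x)) ^+ 2)%:E)%E
  = (complex.Re (expectC (fun x => f x * (f x)^*)))%:E.
Proof.
move=> bf; have [rb _] := bounded_cmfunM bf (bounded_cmfun_conj bf).
rewrite /= /Rintegral fineK; last first.
  by apply: integrable_fin_num => //; exact: bounded_mfun_integrable.
apply: eq_integral => x _; congr (_%:E).
case: (f x) => a b /=; rewrite sqr_sqrtr ?addr_ge0 ?sqr_ge0 //.
by rewrite mulrN opprK -!expr2.
Qed.

Lemma expectC_preserving (phi : T -> T) f : measurable_fun setT phi ->
  (forall A, measurable A -> P (phi @^-1` A) = P A) -> bounded_cmfun f ->
  expectC (f \o phi) = expectC f.
Proof.
move=> mphi Pphi bf.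
have key u : bounded_mfun u -> (\int[P]_x u (phi x)) = \int[P]_x u x.
  move=> bu; have [mu [M uM]] := bu; congr fine.
  rewrite [RHS](eq_measure_integral (pushforward P phi)); last first.
    by move=> A mA _; exact/esym/Pphi.
  rewrite integral_pushforward //; first exact/measurable_EFinP.
  rewrite preimage_setT; apply: bounded_mfun_integrable; split.
    exact: measurableT_comp.
  by exists M.
by case: bf => rf jf; congr Complex; [exact: key rf|exact: key jf].
Qed.

End Expectation.

(** * Haar measure on the unitary group *)

Section UnitaryTopology.
Local Open Scope classical_set_scope.
Variables (R : realType) (N : nat).
Implicit Types U V W : unitary_group R N.

(** A neighbourhood of a matrix is a finite product of neighbourhoods of its
entries. *)
Lemma mx_continuous (T : topologicalType) (p q : nat) (K : topologicalType)
    (F : T -> 'M[K]_(p, q)) :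
  (forall i j, continuous (fun x => F x i j)) -> continuous F.
Proof.
move=> Fc x A [B nB sBA]; rewrite nbhs_filterE /=.
have : nbhs x [set y | forall i j, B i j (F y i j)].
  apply: filter_forall => i; apply: filter_forall => j.
  by apply: Fc; exact: nB.
by apply: filterS => y By; apply: sBA.
Qed.

Lemma entry_continuous (i j : 'I_N) :
  continuous (fun U => (umx U : 'M[R[i]^o]_N) i j : R[i]^o).
Proof.
move=> U; apply: (@continuous_comp _ _ _ (@unitary_incl R N)
  (fun M : 'M[R[i]^o]_N => M i j : R[i]^o)).
  exact: initial_continuous.
exact: coord_continuous.
Qed.

Lemma unitary_mul_continuous V : continuous (fun U => (V * U)%g : unitary_group R N).
Proof.
apply: (@continuous_comp_initial _ _ _ (@unitary_incl R N)).
apply: mx_continuous => i j.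
pose t k : unitary_group R N -> R[i]^o := fun U => umx V i k * umx U k j.
have ct k : continuous (t k).
  move=> U; apply: (@continuous_comp _ _ _ (fun W => umx W k j : R[i]^o)
    (fun z : R[i]^o => (umx V i k : R[i]^o) * z)).
    exact: entry_continuous.
  exact: (@mulrl_continuous R[i]).
have -> : (fun U => (unitary_incl (V * U)%g) i j) = (fun U => \sum_k t k U).
  by apply/funext => U; rewrite /unitary_incl /= mxE.
elim: (index_enum _) => [|k s IHs] U.
  have -> : (fun U => \sum_(k <- [::]) t k U) = cst 0.
    by apply/funext => W; rewrite big_nil.
  exact: cst_continuous.
have -> : (fun U => \sum_(l <- k :: s) t l U) = (fun U => t k U + \sum_(l <- s) t l U).
  by apply/funext => W; rewrite big_cons.
exact: (@continuousD _ R[i]^o _ (t k)  _ U (ct k U) (IHs U)).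
Qed.

Lemma open_measurable_unitary (A : set (unitary_group R N)) : open A -> measurable A.
Proof. by move=> oA; apply: sub_sigma_algebra. Qed.

Lemma continuous_measurable_unitary (f : unitary_group R N -> R) :
  continuous f -> measurable_fun setT f.
Proof.
move=> /continuousP cf; apply: (measurability _ (RGenOpens.measurableE R)).
move=> _ [_ [a [b ->] <-]]; rewrite setTI.
apply: open_measurable_unitary; apply: cf; exact: interval_open.
Qed.

Lemma unitary_mul_measurable V : measurable_fun setT (fun U => (V * U)%g).
Proof.
apply: (@measurability _ _ (unitary_group R N) (unitary_group R N) setT _ open) => //.
move=> _ [A oA <-]; rewrite setTI; apply: open_measurable_unitary.
by have /continuousP := @unitary_mul_continuous V; apply.
Qed.

Lemma ReIm_lipschitz (h : R[i] -> R) :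
  (forall z, (`|h z|%:C <= `|z|)%C) -> {morph h : x y / x - y} ->
  continuous (h : R[i]^o -> R).
Proof.
move=> hle hB z A /nbhs_ballP[e /= e0 eA].
have ec0 : 0 < (e%:C)%C by rewrite ltcR.
apply: (@filterS _ _ (@nbhs_filter R[i]^o z) _ _ _ (nbhsx_ballx (z : R[i]^o) _ ec0)) => w zw.
by apply: eA; rewrite /ball /= -hB -ltcR; apply: le_lt_trans (hle _) zw.
Qed.

(** The rows of a unitary matrix have norm one, which bounds its entries:
hence polynomials in the entries and their conjugates are integrable. *)
Lemma bounded_cmfun_entry (i j : 'I_N) :
  bounded_cmfun (fun U : unitary_group R N => umx U i j).
Proof.
have normU U : `|umx U i j| <= 1.
  have /unitarymxP/matrixP/(_ i i) := umxP U.
  rewrite !mxE eqxx mulr1n (bigD1 j) //= !mxE -normCK => Usum.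
  rewrite -(ler_pXn2r (_ : 0 < 2)%N) ?nnegrE // expr1n -Usum lerDl.
  by apply: sumr_ge0 => l _; rewrite !mxE -normCK exprn_ge0.
have key (h : R[i] -> R) : (forall z, (`|h z|%:C <= `|z|)%C) ->
    {morph h : x y / x - y} -> bounded_mfun (fun U : unitary_group R N => h (umx U i j)).
  move=> hle hB; split.
    apply: continuous_measurable_unitary => U.
    apply: (@continuous_comp _ _ _ (fun W => umx W i j : R[i]^o) (h : R[i]^o -> R)).
      exact: entry_continuous.
    exact: ReIm_lipschitz.
  by exists 1 => U; rewrite -lecR; apply: le_trans (hle _) (normU U).
split; apply: key => [[a b]|[a b] [c e] //].
  exact: normc_ge_Re.
by rewrite normc_def lecR /= -sqrtr_sqr ler_wsqrtr // lerDr sqr_ge0.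
Qed.

(** The preimage of a set under translation by [V] is its image under
translation by the inverse of [V], to which the Haar hypothesis applies. *)
Lemma expectC_left_invariant (P : probability (unitary_group R N) R) V
    (f : unitary_group R N -> R[i]) : haar P -> bounded_cmfun f ->
  expectC P (fun U => f (V * U)%g) = expectC P f.
Proof.
move=> hP bf; apply: (expectC_preserving (@unitary_mul_measurable V)) => // A mA.
rewrite -(hP V^-1%g A mA); congr (P _); apply/seteqP; split => [U /= AU|_ [U AU <-] /=].
  by exists (V * U)%g => //; rewrite mulKg.
by rewrite mulVKg.
Qed.

End UnitaryTopology.

(** * Correlations of permutation traces *)

Section Correlations.
Local Open Scope sesquilinear_scope.
Variables (R : realType) (N n : nat) (P : probability (unitary_group R N) R).
Hypothesis hP : haar P.
Implicit Types (f g h l : {ffun 'I_n -> 'I_N}) (s t : 'S_n).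

Lemma bounded_tpow f g : bounded_cmfun (fun U : unitary_group R N => tpow U f g).
Proof. by apply: bounded_cmfun_prod => a _; exact: bounded_cmfun_entry. Qed.

Lemma bounded_tpow_pair f g h l :
  bounded_cmfun (fun U : unitary_group R N => tpow U f g * (tpow U h l)^*%C).
Proof.
by apply: bounded_cmfunM; [|apply: bounded_cmfun_conj]; exact: bounded_tpow.
Qed.

(** For fixed [g] and [l], the kernel [corr f g h l] in [f] and [h] is the
average over the group of the conjugates of the matrix unit at [g, l] by the
tensor power of [U]. *)
Definition corr f g h l : R[i] := expectC P (fun U => tpow U f g * (tpow U h l)^*%C).

Lemma corr_left_invariant (V : 'M[R[i]]_N) f g h l : V \is unitarymx ->
  corr f g h l =
  \sum_f' \sum_h' (tpow V f f' * (tpow V h h')^*%C) * corr f' g h' l.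
Proof.
move=> VU; rewrite /corr -(expectC_left_invariant (UnitaryGroup VU) hP); last first.
  exact: bounded_tpow_pair.
transitivity (expectC P (fun U => \sum_f' \sum_h' (tpow V f f' * (tpow V h h')^*%C) *
    (tpow U f' g * (tpow U h' l)^*%C))).
  congr expectC; apply/funext=> U /=; rewrite !tpowM rmorph_sum mulr_suml.
  apply: eq_bigr => f' _; rewrite mulr_sumr; apply: eq_bigr => h' _.
  by rewrite rmorphM mulrACA.
have bZ f' h' : bounded_cmfun (fun U : unitary_group R N =>
    (tpow V f f' * (tpow V h h')^*%C) * (tpow U f' g * (tpow U h' l)^*%C)).
  by apply: bounded_cmfunM; [exact: bounded_cmfun_cst|exact: bounded_tpow_pair].
rewrite expectC_sum => [|f']; last by apply: bounded_cmfun_sum.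
apply: eq_bigr => f' _; rewrite expectC_sum //; apply: eq_bigr => h' _.
by rewrite expectCZ //; exact: bounded_tpow_pair.
Qed.

(** An average of conjugates is unchanged by one more conjugation; multiplying
by [tpow V] on the right turns this invariance into commutation. *)
Lemma corr_tpow_commute g l (V : 'M[R[i]]_N) : V \is unitarymx ->
  tpow_commute (fun f h => corr f g h l) V.
Proof.
move=> VU f h.
pose O h' : R[i] := \sum_k (tpow V k h')^*%C * tpow V k h.
have VV h' : O h' = (h' == h)%:R.
  exact: (tpow_col_orthonormal h' h VU).
transitivity (\sum_f' \sum_h' (tpow V f f' * corr f' g h' l) * O h').
  under eq_bigr do rewrite (corr_left_invariant _ _ _ _ VU) mulr_suml.
  rewrite exchange_big; apply: eq_bigr => f' _ /=.
  under eq_bigr do rewrite mulr_suml.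
  rewrite exchange_big; apply: eq_bigr => h' _ /=.
  rewrite mulr_sumr; apply: eq_bigr => k _.
  by rewrite [RHS]mulrA; congr (_ * _); rewrite mulrAC.
apply: eq_bigr => f' _; rewrite (bigD1 h) //= big1 ?addr0 => [|h' /negPf hh'].
  by rewrite VV eqxx mulr1.
by rewrite VV hh' mulr0.
Qed.

Lemma sum_corr_diag f h : \sum_g corr f g h g = (f == h)%:R.
Proof.
rewrite /corr -expectC_sum => [|g]; last exact: bounded_tpow_pair.
rewrite -[RHS](expectC_cst P); congr expectC; apply/funext => U.
exact: (tpow_row_orthonormal f h (umxP U)).
Qed.

Hypothesis nN : (n <= N)%N.

(** By the commutant expansion, a correlation is determined by its values at
the rearrangements of one injection [f0]. The sums over the remaining index are
then orthonormality relations, and these select the permutations [r] with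
[s * r = r * t]. *)
Lemma expectC_perm_trace s t :
  expectC P (fun U => perm_trace U s * (perm_trace U t)^*%C)
  = \sum_(r : 'S_n) (t == s ^ r)%g%:R.
Proof.
pose f0 : {ffun 'I_n -> 'I_N} := [ffun a => widen_ord nN a].
have inj0 : injective f0.
  by move=> a b; rewrite !ffunE => /(congr1 val) /= ?; apply: val_inj.
transitivity (\sum_h \sum_f corr f (precomp f s) h (precomp h t)).
  rewrite exchange_big /= /corr.
  transitivity (\sum_f expectC P (fun U => \sum_h
      tpow U f (precomp f s) * (tpow U h (precomp h t))^*%C)); last first.
    by apply: eq_bigr => f _; apply: expectC_sum => h; exact: bounded_tpow_pair.
  rewrite -expectC_sum => [|f]; last by apply: bounded_cmfun_sum => *; exact: bounded_tpow_pair.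
  have tr (U : unitary_group R N) u : perm_trace U u = \sum_f tpow U f (precomp f u).
    by apply: eq_bigr => f _; apply: eq_bigr => a _; rewrite ffunE.
  congr expectC; apply/funext => U; rewrite !tr rmorph_sum mulr_suml.
  by apply: eq_bigr => f _; rewrite mulr_sumr.
transitivity (\sum_h \sum_(r : 'S_n)
    corr (precomp f0 r) (precomp (precomp h r) s) f0 (precomp h t)).
  apply: eq_bigr => h _.
  transitivity (\sum_f \sum_(r : 'S_n) (f == precomp h r)%:R *
      corr (precomp f0 r) (precomp f s) f0 (precomp h t)).
    apply: eq_bigr => f _.
    exact: (commutant_expansion (corr_tpow_commute (precomp f s) (precomp h t)) h f inj0).
  rewrite exchange_big; apply: eq_bigr => r _ /=.
  rewrite (bigD1 (precomp h r)) //= eqxx mul1r big1 ?addr0 // => f /negPf ->.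
  by rewrite mul0r.
rewrite exchange_big; apply: eq_bigr => r _ /=.
rewrite (reindex_inj (can_inj (@precompVK n _ t))) /=.
(* Moving all permutations to the first pair of indices leaves f0 rearranged by u^-1 * r. *)
pose u := (s * r * t^-1)%g.
transitivity (\sum_h corr (precomp f0 (u^-1 * r)%g) h f0 h).
  apply: eq_bigr => h _; rewrite precompVK !precompM -/u /corr; congr expectC.
  apply/funext => U; rewrite -(tpow_precomp U (precomp f0 (u^-1 * r)%g) h u) precompM.
  by rewrite mulKVg.
rewrite sum_corr_diag -{2}[f0]precomp1 (inj_eq (precomp_inj inj0)).
congr (_%:R); congr nat_of_bool; rewrite conjgE; apply/eqP/eqP => [|te].
  move=> /(canRL (mulKVg _)); rewrite mulg1 => re.
  by rewrite -(mulgKV t (s * r)%g) -/u -re mulKg.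
suff -> : u = r by rewrite mulVg.
by rewrite /u te invMg mulKVg invgK.
Qed.

End Correlations.

(** * The secular moment *)

Lemma det_unitary_conj (C : numClosedFieldType) (N : nat) (V : 'M[C]_N) :
  V \is unitarymx -> \det V * (\det V)^* = 1.
Proof.
by move=> /unitarymxP/(congr1 determinant); rewrite det_mulmx det_map_mx det_tr det1.
Qed.

(** Factor [V + X] as [V (1 + X V')], where [V'] is the conjugate transpose of
[V]; the coefficients of the second determinant are conjugates of those of
[det (1 + X V)]. *)
Lemma coef_det_unitary_pencil (C : numClosedFieldType) (k N n : nat) (V : 'M[C]_N) :
  V \is unitarymx ->
  (\det (map_mx polyC V + 'X *: map_mx polyC 1%:M) ^+ k)`_n
  = \det V ^+ k * ((\det (1%:M + 'X *: map_mx polyC V) ^+ k)`_n)^*.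
Proof.
move=> /unitarymxP VV.
have -> : map_mx polyC V + 'X *: map_mx polyC 1%:M = map_mx polyC V *m
    map_mx (map_poly Num.conj) (1%:M + 'X *: map_mx polyC V)^T.
  have -> : map_mx (map_poly Num.conj) (1%:M + 'X *: map_mx polyC V)^T =
      1%:M + 'X *: map_mx polyC (V ^T ^ Num.conj)%sesqui.
    apply/matrixP => i j; rewrite !mxE rmorphD rmorphM /= map_polyX map_polyC.
    by rewrite eq_sym rmorphMn rmorph1.
  by rewrite mulmxDr mulmx1 -scalemxAr -map_mxM VV.
rewrite det_mulmx exprMn !det_map_mx det_tr -!rmorphXn /= coefCM; congr (_ * _).
by rewrite coef_map.
Qed.

Section SecularMoment.
Variables (R : realType) (k N : nat).
Implicit Types (U : unitary_group R N).

Definition det_power_coef (m : nat) U : R[i] :=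
  (\det (1%:M + 'X *: map_mx polyC (umx U)) ^+ k)`_m.

Lemma det_power_coefE m U : det_power_coef m U =
  (\det (map_mx polyC 1%:M + 'X *: map_mx polyC ((1%:M : 'M[R[i]]_k) *t umx U)))`_m.
Proof. by rewrite /det_power_coef -{1}[1%:M](map_mx1 polyC) -det_pencil_tens tens11mx. Qed.

(** The coefficient is a polynomial in the entries of [U]. *)
Lemma bounded_det_power_coef m : bounded_cmfun (det_power_coef m).
Proof.
have -> : det_power_coef m = (fun U => \sum_(S : {set 'I_(k * N)} | #|S| == m)
    \sum_(s : 'S_(k * N)) (-1) ^+ s *
      \prod_i mix_rows S ((1%:M : 'M[R[i]]_k) *t umx U) 1%:M i (s i)).
  by apply/funext => U; rewrite det_power_coefE coef_det_pencil.
apply: bounded_cmfun_sum => S _; apply: bounded_cmfun_sum => s _.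
apply: bounded_cmfunM; first exact: bounded_cmfun_cst.
apply: bounded_cmfun_prod => i _.
have [iS|/negPf iS] := boolP (i \in S); under eq_fun do rewrite mxE iS; last first.
  exact: bounded_cmfun_cst.
under eq_fun do rewrite mxE.
by apply: bounded_cmfunM; [exact: bounded_cmfun_cst|exact: bounded_cmfun_entry].
Qed.

(** The functional equation of the characteristic polynomial of a unitary
matrix. *)
Lemma det_power_coef_rev n U : (n <= k * N)%N ->
  det_power_coef (k * N - n) U = \det (umx U) ^+ k * (det_power_coef n U)^*%C.
Proof.
move=> nkN; rewrite det_power_coefE coef_det_pencil_rev // -tens11mx det_pencil_tens.
exact: coef_det_unitary_pencil (umxP U).
Qed.

Lemma det_power_coef_sqr n U : (n <= k * N)%N ->
  det_power_coef (k * N - n) U * (det_power_coef (k * N - n) U)^*%C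
  = det_power_coef n U * (det_power_coef n U)^*%C.
Proof.
move=> nkN; rewrite det_power_coef_rev // rmorphM /= conjcK mulrACA rmorphXn -exprMn.
have -> : \det (umx U) * (\det (umx U))^*%C = 1.
  exact: det_unitary_conj (umxP U).
by rewrite expr1n mul1r mulrC.
Qed.

(** In the double sum over [s] and [t], only conjugate pairs contribute, and
sign and number of fixed colourings are class functions. What is left is
[n`!] times the sum over [s] of [(card_fixed_colorings k s) ^ 2], which is the
number of fixed colourings with [k ^ 2] colours, and the orbit-counting lemma
applies. *)
Lemma expectC_det_power_coef (P : probability (unitary_group R N) R) n :
  haar P -> (0 < k)%N -> (n <= N)%N ->
  expectC P (fun U => det_power_coef n U * (det_power_coef n U)^*%C)
  = ('C(n + (k ^ 2).-1, n))%:R.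
Proof.
move=> hP k0 nN; have nf0 : (n`!%:R : R[i]) != 0 by rewrite pnatr_eq0 -lt0n fact_gt0.
have bT (s : 'S_n) : bounded_cmfun (fun U => perm_trace (umx U) s).
  apply: bounded_cmfun_sum => g _; apply: bounded_cmfun_prod => a _.
  exact: bounded_cmfun_entry.
have bTT (s t : 'S_n) :
    bounded_cmfun (fun U => perm_trace (umx U) s * (perm_trace (umx U) t)^*%C).
  by apply: bounded_cmfunM => //; apply: bounded_cmfun_conj.
pose w (s : 'S_n) : R[i] := (-1) ^+ s * (card_fixed_colorings k s)%:R.
have wJ s : (w s)^*%C = w s.
  by rewrite /w rmorphM rmorphXn rmorphN1 rmorph_nat.
(* One factor n! for each of the two conjugate coefficients. *)
apply: (mulfI nf0); apply: (mulfI nf0).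
transitivity (\sum_(s : 'S_n) \sum_(t : 'S_n) (w s * w t) *
    expectC P (fun U => perm_trace (umx U) s * (perm_trace (umx U) t)^*%C)).
  have bc := bounded_cmfunM (bounded_det_power_coef n)
    (bounded_cmfun_conj (bounded_det_power_coef n)).
  rewrite -!expectCZ; first last.
  - exact: bc.
  - by apply: bounded_cmfunM; [exact: bounded_cmfun_cst|exact: bc].
  transitivity (expectC P (fun U => \sum_(s : 'S_n) \sum_(t : 'S_n) (w s * w t) *
     (perm_trace (umx U) s * (perm_trace (umx U) t)^*%C))).
    congr expectC; apply/funext => U.
    have cE : n`!%:R * det_power_coef n U = \sum_(s : 'S_n) w s * perm_trace (umx U) s.
      by rewrite mulr_natl coef_det_exp.
    transitivity ((n`!%:R * det_power_coef n U) * (n`!%:R * det_power_coef n U)^*%C).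
      by rewrite rmorphM rmorph_nat mulrACA !mulrA.
    rewrite cE rmorph_sum mulr_suml; apply: eq_bigr => s _.
    rewrite mulr_sumr; apply: eq_bigr => t _.
    by rewrite rmorphM /= wJ mulrACA.
  have bZ s t : bounded_cmfun (fun U => (w s * w t) *
     (perm_trace (umx U) s * (perm_trace (umx U) t)^*%C)).
    by apply: bounded_cmfunM => //; exact: bounded_cmfun_cst.
  rewrite expectC_sum => [|s]; last exact: bounded_cmfun_sum.
  apply: eq_bigr => s _; rewrite expectC_sum //; apply: eq_bigr => t _.
  exact: expectCZ.
under eq_bigr do under eq_bigr do rewrite expectC_perm_trace // mulr_sumr.
under eq_bigr do rewrite exchange_big.
rewrite exchange_big /=.
transitivity (\sum_(r : 'S_n) \sum_(s : 'S_n) (card_fixed_colorings (k * k) s)%:R : R[i]).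
  apply: eq_bigr => r _; apply: eq_bigr => s _.
  rewrite (bigD1 (s ^ r)%g) //= eqxx mulr1 big1 ?addr0 => [|t /negPf ->]; last first.
    by rewrite mulr0.
  rewrite /w odd_permJ card_fixed_coloringsJ mulrACA -expr2 sqrr_sign mul1r -natrM.
  by rewrite card_fixed_coloringsM.
rewrite sumr_const card_Sn -natr_sum -{1}(prednK (_ : 0 < k * k)%N) ?muln_gt0 ?k0 //.
rewrite sum_card_fixed_colorings natrM mulnn.
by rewrite -[LHS]mulr_natl [in LHS](mulrC _ n`!%:R).
Qed.

End SecularMoment.

Theorem theorem1p3 (R : realType) (k N m : nat)
    (mu : probability (unitary_group R N) R) :
  (1 <= k)%N -> (1 <= N)%N -> haar mu ->
  ((k - 1) * N < m)%N -> (m < k * N)%N ->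
  secular_moment mu k m = ('C(k * N - m + k ^ 2 - 1, k ^ 2 - 1))%:R%:E.
Proof.
move=> k0 N0 hmu mlo mhi; set n := (k * N - m)%N.
(* As m exceeds (k - 1) N, there are at least n distinct basis vectors. *)
have nN : (n <= N)%N.
  by rewrite leq_subLR -{1}(subnK k0) mulnDl mul1n leq_add2r ltnW.
have nkN : (n <= k * N)%N by apply: leq_subr.
have mE : m = (k * N - n)%N by rewrite subKn // ltnW.
rewrite /secular_moment.
under eq_integral do rewrite secular_sumE.
rewrite (integral_normc_sqr mu (@bounded_det_power_coef R k N m)).
have -> : (fun U : unitary_group R N => det_power_coef k m U * (det_power_coef k m U)^*%C) =
          (fun U => det_power_coef k n U * (det_power_coef k n U)^*%C).
  by apply/funext => U; rewrite {1 2}mE det_power_coef_sqr.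
rewrite expectC_det_power_coef //.
have -> : 'C(n + k ^ 2 - 1, k ^ 2 - 1) = 'C(n + (k ^ 2).-1, n).
  rewrite -addnBA ?expn_gt0 ?k0 // !subn1 -[RHS]bin_sub ?leq_addr //.
  by rewrite addKn.
by congr (_%:E); rewrite -[X in complex.Re X](rmorph_nat (real_complex R)).
Qed.
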